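(* Every edge-transitive connected $GI$-graph $GI(n;j_0,\dots,j_{t-1})$ with $t\ge 2$ layers is isomorphic to one of the following eight graphs: $G(4,1)$, $G(5,2)$, $G(8,3)$, $G(10,2)$, $G(10,3)$, $G(12,5)$, $G(24,5)$, $GI(3;1,1,1)$.
   Context: For integers $n\ge 3$, $t\ge 1$ and a sequence $j_0,\dots,j_{t-1}$ of integers with $0<j_k<n$ and $j_k\neq n/2$, the $GI$-graph $GI(n;j_0,\dots,j_{t-1})$ is the graph with vertex set $\mathbb{Z}_t\times\mathbb{Z}_n$ and two types of edges: spoke edges, joining $(s,v)$ to $(s',v)$ for all distinct $s,s'\in\mathbb{Z}_t$ and all $v\in\mathbb{Z}_n$; and layer edges, joining $(s,v)$ to $(s,v+j_s)$ and $(s,v-j_s)$ for all $s\in\mathbb{Z}_t$, $v\in\mathbb{Z}_n$. It has $t$ layers $L_s=\{(s,v):v\in\mathbb{Z}_n\}$, $s\in\mathbb{Z}_t$. The generalized Petersen graph $G(n,k)$ is the graph $GI(n;1,k)$. *)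

(* Defs.v *)
From mathcomp Require Import all_boot all_order all_algebra all_fingroup.

Set Implicit Arguments.
Unset Strict Implicit.
Unset Printing Implicit Defensive.

Import GRing.Theory.

(** A finite graph is given by its adjacency relation [e : rel V]; it is simple
    and undirected when [e] is symmetric and irreflexive. *)

Definition graph_connected (V : finType) (e : rel V) : Prop :=
  forall x y : V, connect e x y.

Definition edges (V : finType) (e : rel V) : {set {set V}} :=
  [set [set p.1; p.2] | p in [set p : V * V | e p.1 p.2]].

Definition graph_aut (V : finType) (e : rel V) : {set {perm V}} :=
  [set f : {perm V} | [forall x, forall y, e (f x) (f y) == e x y]].

(** ['P^*] is the action of permutations on sets of vertices, so this is
    transitivity of the automorphism group on the unordered pairs of adjacent
    vertices.  [atransitive] also requires a nonempty edge set, which holds for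
    [GI n j] below whenever there is at least one layer. *)
Definition edge_transitive (V : finType) (e : rel V) : Prop :=
  [transitive graph_aut e, on edges e | 'P^*].

Definition graph_iso (V W : finType) (e : rel V) (e' : rel W) : Prop :=
  exists2 f : V -> W, bijective f & forall x y, e' (f x) (f y) = e x y.

(** The first disjunct gives the spoke edges, the second the layer edges.
    The layer index is only used as a label, so [Z_t] is rendered by ['I_t].
    ['Z_n] is the ring of integers mod [n] as soon as [1 < n]. *)
Definition GI (n t : nat) (j : t.-tuple nat) : rel ('I_t * 'Z_n) :=
  fun x y =>
    (x.1 != y.1) && (x.2 == y.2)
    || (x.1 == y.1) && ((y.2 == x.2 + (tnth j x.1)%:R)%R
                        || (y.2 == x.2 - (tnth j x.1)%:R)%R).

Arguments GI n {t} j.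

Definition petersen (n k : nat) : rel ('I_2 * 'Z_n) := GI n [tuple 1; k].

Arguments petersen : clear implicits.

Lemma graph_autP (V : finType) (e : rel V) (f : {perm V}) :
  reflect (forall x y, e (f x) (f y) = e x y) (f \in graph_aut e).
Proof.
rewrite inE; apply: (iffP forallP) => [H x y|H x].
  by apply/eqP; have /forallP := H x.
by apply/forallP => y; rewrite H.
Qed.

Lemma graph_aut_group_set (V : finType) (e : rel V) : group_set (graph_aut e).
Proof.
apply/group_setP; split=> [|f g /graph_autP Hf /graph_autP Hg].
  by apply/graph_autP => x y; rewrite !perm1.
by apply/graph_autP => x y; rewrite !permM Hg Hf.
Qed.

Canonical graph_aut_group (V : finType) (e : rel V) :=
  Group (graph_aut_group_set e).

Lemma GI_sym (n t : nat) (j : t.-tuple nat) : symmetric (GI n j).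
Proof.
move=> [s u] [r v]; rewrite /GI /= [r == s]eq_sym [v == u]eq_sym.
have [<-|//] := eqVneq s r; set a := (_%:R)%R => /=.
by rewrite -subr_eq eq_sym [(v == _)%R]eq_sym subr_eq orbC.
Qed.

Lemma GI_irrefl (n t : nat) (j : t.-tuple nat) :
  1 < n -> (forall s, 0 < tnth j s < n) -> irreflexive (GI n j).
Proof.
move=> n1 hj [s u]; rewrite /GI /= !eqxx /=; have /andP[j0 jn] := hj s.
have /negPf jN0 : ((tnth j s)%:R != 0 :> 'Z_n)%R.
  by rewrite -val_eqE /= val_Zp_nat // modn_small // -lt0n.
by rewrite eq_sym -[X in (_ == X)%R]addr0 (inj_eq (addrI u)) jN0 /=
           -[X in (X == _)%R]addr0 (inj_eq (addrI u)) eq_sym oppr_eq0.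
Qed.

(* Main.v *)
Require Import Defs.
From mathcomp Require Import all_boot all_order all_algebra all_fingroup.
From mathcomp Require Import zify ring.

(** An automorphism preserves the number of triangles and the number of closed
    walks of each kind through an edge, so in an edge-transitive graph these
    numbers are the same for spoke edges and for layer edges.

    Three or more layers: a spoke edge lies in at least [t - 2] triangles, and a
    layer edge of layer [s] in at most one, in one only if [3 j_s = 0] mod [n].
    Hence [t = 3] and [3 j_s = 0] for all [s].  The map [(s, v) |-> 3 v] is then
    constant on edges, so connectedness forces [n = 3]
    ([edge_transitive_many_layers]).

    Two layers: the graph is cubic, and we count the closed walks without
    backtracking of a given length through each edge.  A walk is described by a
    word in the steps spoke, forward, backward; it closes up exactly when the
    word returns to its layer and the net numbers [p], [q] of steps made in the
    two layers satisfy [p j_0 + q j_1 = 0] mod [n].  The counts are therefore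
    explicit sums of indicators of such relations ([edge_relations_balanced]).
    In length 8 the trivial relation, which comes from the cycles that commute a
    step of one layer with a step of the other, favours the spokes; equality of
    the counts needs other relations to compensate for this in both layers
    ([balanced8_relations]).  Two independent relations bound [n] by their
    determinant, again by connectedness ([vanish_det]), whence [n <= 26]
    ([balanced8_bound]).

    For [n <= 26], length 8 leaves, up to multiplying both steps by a unit mod
    [n], changing their signs and exchanging the layers, the seven generalized
    Petersen graphs of the theorem together with [G(13,5)] and [G(26,5)], and
    these two are eliminated by the count in length 10
    ([small_exceptional]). *)

Set Implicit Arguments.
Unset Strict Implicit.
Unset Printing Implicit Defensive.
Import GRing.Theory.

(** * Numerical invariants of edges *)

Section EdgeInvariants.
Variables (V : finType) (e : rel V).

Lemma edge_transitiveP (x y x' y' : V) :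
  edge_transitive e -> e x y -> e x' y' ->
  exists2 f : {perm V}, f \in graph_aut e &
    (x', y') = (f x, f y) \/ (x', y') = (f y, f x).
Proof.
move=> trans_e exy exy'.
have edgeP u v : e u v -> [set u; v] \in edges e.
  by move=> euv; apply/imsetP; exists (u, v); rewrite // inE.
have [f autf eqf] := atransP2 trans_e (edgeP _ _ exy) (edgeP _ _ exy').
have {}eqf : [set x'; y'] = [set f x; f y].
  by rewrite eqf /= /setact imsetU !imset_set1.
exists f => //.
have: x' \in [set f x; f y] by rewrite -eqf set21.
have: y' \in [set f x; f y] by rewrite -eqf set22.
have: f x \in [set x'; y'] by rewrite eqf set21.
have: f y \in [set x'; y'] by rewrite eqf set22.
rewrite !inE => /orP[]/eqP a /orP[]/eqP b /orP[]/eqP c /orP[]/eqP d;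
  by [left; congruence | right; congruence].
Qed.

(** An unordered edge can be mapped to another with either orientation, whence
    the symmetry required of [F]. *)
Lemma edge_transitive_invariant (T : Type) (F : V -> V -> T) (x y x' y' : V) :
  (forall f u v, f \in graph_aut e -> F (f u) (f v) = F u v) ->
  (forall u v, F u v = F v u) ->
  edge_transitive e -> e x y -> e x' y' -> F x y = F x' y'.
Proof.
move=> Faut Fsym trans_e exy exy'.
have [f autf [] [-> ->]] := edge_transitiveP trans_e exy exy'.
  by rewrite Faut.
by rewrite Faut // Fsym.
Qed.

Definition triangles (x y : V) := #|[set z | e x z && e y z]|.

Lemma triangles_aut f x y :
  f \in graph_aut e -> triangles (f x) (f y) = triangles x y.
Proof.
move=> /graph_autP autf; rewrite /triangles.
rewrite -[RHS](card_imset _ (@perm_inj _ f)).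
apply: eq_card => z; rewrite inE; apply/idP/imsetP => [ez | [w + ->]].
  by exists ((f^-1)%g z); rewrite ?permKV // inE -(autf x) -(autf y) permKV.
by rewrite inE !autf.
Qed.

Lemma triangles_sym x y : triangles x y = triangles y x.
Proof. by apply: eq_card => z; rewrite !inE andbC. Qed.

(** The entries of the powers of the nonbacktracking (Hashimoto) matrix of the
    graph, which is indexed by the arcs [(x, y)]: [nb_walks L x0 y0 x y] is the
    entry of its [L]-th power from the arc [(x, y)] to the arc [(x0, y0)]. *)
Fixpoint nb_walks L (x0 y0 x y : V) : nat :=
  if L is L'.+1 then \sum_(z | e y z && (z != x)) nb_walks L' x0 y0 y z
  else (x == x0) && (y == y0).

Lemma nb_walks_aut f L x0 y0 x y :
  f \in graph_aut e ->
  nb_walks L (f x0) (f y0) (f x) (f y) = nb_walks L x0 y0 x y.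
Proof.
move=> /graph_autP autf.
elim: L x y => [|L IHL] x y /=; first by rewrite !(inj_eq perm_inj).
rewrite (reindex_inj (@perm_inj _ f)) /=.
apply: eq_big => [z|z _]; by rewrite ?IHL // autf (inj_eq perm_inj).
Qed.

(** Both orientations of the edge are added up so that the invariant does not
    depend on the orientation. *)
Definition closed_walks L x y := nb_walks L x y x y + nb_walks L y x y x.

Lemma closed_walks_edge L x y x' y' :
  edge_transitive e -> e x y -> e x' y' ->
  closed_walks L x y = closed_walks L x' y'.
Proof.
apply: edge_transitive_invariant => [f u v autf | u v].
  by rewrite /closed_walks !nb_walks_aut.
by rewrite /closed_walks addnC.
Qed.
End EdgeInvariants.

(** * Residues, isomorphisms and connectedness of GI-graphs *)

Lemma Zp_int_eq0 n (z : int) :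
  1 < n -> (z%:~R == 0 :> 'Z_n)%R = (n %| absz z).
Proof.
move=> n1; have natE m : (m%:R == 0 :> 'Z_n)%R = (n %| m).
  by rewrite -val_eqE /= val_Zp_nat.
by case: z => m; rewrite ?NegzE ?mulrNz ?oppr_eq0 -?pmulrn natE // abszN.
Qed.

Lemma Zp_nat_eq0 n m : 1 < n -> (m%:R == 0 :> 'Z_n)%R = (n %| m).
Proof. by move=> n1; rewrite pmulrn Zp_int_eq0. Qed.

Definition eq_up_to_sign n a b := (n %| absz (a%:Z - b%:Z)%R) || (n %| a + b).

Lemma eq_up_to_signP n a b : 1 < n -> eq_up_to_sign n a b ->
  (a%:R = b%:R :> 'Z_n \/ a%:R = - b%:R :> 'Z_n)%R.
Proof.
move=> n1 /orP[]; rewrite -?Zp_int_eq0 // -?Zp_nat_eq0 //.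
  by rewrite rmorphB /= -!pmulrn subr_eq0 => /eqP; left.
by rewrite natrD addr_eq0 => /eqP; right.
Qed.

(** Multiplication by a unit of Z_n maps layer edges to layer edges, and the
    signs of the steps do not matter. *)
Lemma GI_iso_scale n t (j j' : t.-tuple nat) (u : nat) (f : 'I_t -> 'I_t) :
  1 < n -> coprime n u -> injective f ->
  (forall s, eq_up_to_sign n (u * tnth j s) (tnth j' (f s))) ->
  graph_iso (GI n j) (GI n j').
Proof.
move=> n1 co_u inj_f scale_j.
have unit_u : (u%:R : 'Z_n)%R \is a GRing.unit by rewrite unitZpE.
have mulI := mulrI unit_u.
pose h (x : 'I_t * 'Z_n) := (f x.1, u%:R * x.2)%R.
have inj_h : injective h.
  move=> [s v] [r w] /eqP.
  by rewrite xpair_eqE /= (inj_eq inj_f) (inj_eq mulI) => /andP[/eqP-> /eqP->].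
exists h => [|[s v] [r w]]; first exact: injF_bij.
rewrite /GI /= (inj_eq inj_f) (inj_eq mulI).
have [_|] //= := eqVneq s r.
rewrite -(inj_eq mulI w (v + _)%R) -(inj_eq mulI w (v - _)%R).
rewrite mulrDr mulrBr -natrM.
by have [-> // | ->] := eq_up_to_signP n1 (scale_j s); rewrite opprK orbC.
Qed.

(** If [m] kills every step, then [(s, v) |-> m v] is constant along edges, hence
    constant, so that [m = m 1 = m 0 = 0] mod [n]. *)
Lemma connected_dvd n t (j : t.-tuple nat) (m : int) :
  1 < n -> 0 < t -> graph_connected (GI n j) ->
  (forall s, m%:~R * (tnth j s)%:R = 0 :> 'Z_n)%R -> n %| absz m.
Proof.
move=> n1 t0 conn_j mj0; rewrite -Zp_int_eq0 //.
have inv : closed (GI n j) [pred x | m%:~R * x.2 == 0 :> 'Z_n]%R.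
  move=> [s v] [r w]; rewrite /GI !inE /=.
  case/orP => /andP[_]; first by move/eqP->.
  by case/orP => /eqP ->; rewrite ?mulrDr ?mulrN mj0 ?oppr0 addr0.
have := closed_connect inv (conn_j (Ordinal t0, 0%R) (Ordinal t0, 1%R)).
by rewrite !inE /= mulr0 mulr1 eqxx => <-.
Qed.

(** * Triangles, and graphs with at least three layers *)

Section Layers.
Variables (n t : nat) (j : t.-tuple nat).
Hypotheses (n1 : 1 < n) (hj : forall s, 0 < tnth j s < n)
  (hj2 : forall s, 2 * tnth j s != n).
Local Notation J s := ((tnth j s)%:R : 'Z_n)%R.

Lemma step_neq0 s : (J s != 0)%R.
Proof.
rewrite Zp_nat_eq0 //; have /andP[j0 jn] := hj s.
by rewrite gtnNdvd.
Qed.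

Lemma step2_neq0 s : (J s + J s != 0)%R.
Proof.
rewrite -natrD Zp_nat_eq0 // addnn -mul2n; have /andP[j0 jn] := hj s.
apply/negP => /dvdnP[[|[|q]]]; have := hj2 s; nia.
Qed.

Lemma step_neq_opp s v : (v + J s == v - J s)%R = false.
Proof.
by rewrite (inj_eq (addrI v)) -addr_eq0; apply/negbTE/step2_neq0.
Qed.

Lemma GI_spoke s r v : s != r -> GI n j (s, v) (r, v).
Proof. by rewrite /GI /= eqxx => ->. Qed.

Lemma GI_layer s v : GI n j (s, v) (s, v + J s)%R.
Proof. by rewrite /GI /= !eqxx orbT. Qed.

Lemma triangles_spoke s r v :
  s != r -> t - 2 <= triangles (GI n j) (s, v) (r, v).
Proof.
move=> sr.
have -> : t - 2 = #|[set p | p \notin [set s; r]]|.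
  have := cardsC [set s; r]; rewrite cards2 sr card_ord => card_t.
  rewrite -[X in X - _]card_t addKn.
  by apply: eq_card => p; rewrite !inE.
rewrite -[leqLHS](card_imset _
  (fun p q => fun E : (p, v) = (q, v) => congr1 fst E)).
apply/subset_leq_card/subsetP => _ /imsetP[p + ->].
by rewrite !inE /GI /= negb_or ![p == _]eq_sym eqxx !andbT => /andP[-> ->].
Qed.

(** A common neighbour of [(s, v)] and [(s, v + j_s)] lies in the same layer and
    can only be [(s, v - j_s) = (s, v + 2 j_s)]. *)
Lemma triangles_layer s v :
  triangles (GI n j) (s, v) (s, v + J s)%R <= (3%:R * J s == 0)%R.
Proof.
have addJ_neq u : (u + J s == u)%R = false.
  by rewrite -[X in _ == X]addr0 (inj_eq (addrI u)); apply/negbTE/step_neq0.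
have sub : [set z | GI n j (s, v) z && GI n j (s, v + J s)%R z] \subset
           [set z | (z == (s, v - J s)%R) && (3%:R * J s == 0)%R].
  apply/subsetP => -[r w]; rewrite !inE /GI /= xpair_eqE [r == s]eq_sym.
  have [_ | _] := eqVneq s r; last first.
    by rewrite /= !orbF => /andP[/eqP <-]; rewrite addJ_neq.
  rewrite /= => /andP[/orP[]/eqP ->].
    by rewrite addrK [(_ == v)%R]addJ_neq [(_ == _ + _)%R]eq_sym addJ_neq.
  case/orP => /eqP; last by move/eqP; rewrite addrK eq_sym -{1}(subrK (J s) v)
    addJ_neq.
  move=> eq3; rewrite eqxx /=.
  have -> : (3%:R * J s = (v + J s + J s) - (v - J s))%R by ring.
  by rewrite -eq3 subrr.
apply: leq_trans (subset_leq_card sub) _.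
case: (3%:R * J s == 0)%R.
  have -> : [set z | (z == (s, v - J s)%R) && true] = [set (s, v - J s)%R].
    by apply/setP => z; rewrite !inE andbT.
  by rewrite cards1.
by rewrite leqn0 cards_eq0; apply/eqP/setP => z; rewrite !inE andbF.
Qed.

End Layers.

Lemma edge_transitive_many_layers n t (j : t.-tuple nat) :
  3 <= n -> 3 <= t -> (forall s, 0 < tnth j s < n) ->
  graph_connected (GI n j) ->
  edge_transitive (GI n j) -> graph_iso (GI n j) (GI 3 [tuple 1; 1; 1]).
Proof.
move=> n3 t3 hj conn_j trans_j.
have n1 : 1 < n by apply: leq_trans n3.
have t0 : 0 < t by apply: leq_trans t3.
pose s0 := Ordinal t0; pose s1 : 'I_t := Ordinal (leq_trans (isT : 1 < 3) t3).
have le_tri s : t - 2 <= (3%:R * (tnth j s)%:R == 0 :> 'Z_n)%R.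
  apply: leq_trans _ (triangles_layer n1 hj s 0%R).
  have -> := edge_transitive_invariant (@triangles_aut _ _) (@triangles_sym _ _)
    trans_j (GI_layer j s 0%R) (GI_spoke j 0%R (isT : s0 != s1)).
  exact: triangles_spoke.
have Et : t = 3 by have := leq_trans (le_tri s0) (leq_b1 _); lia.
have {le_tri} J3 s : (3%:R * (tnth j s)%:R == 0 :> 'Z_n)%R.
  by move: (le_tri s); case: (3%:R * _ == _)%R => //=; lia.
have dvd3 : n %| 3.
  by apply: (connected_dvd (m := 3) n1 t0 conn_j) => s; apply/eqP/J3.
have En : n = 3 by have := dvdn_leq (isT : 0 < 3) dvd3; lia.
subst n t.
apply: (@GI_iso_scale _ _ _ _ 1 id) => // s.
have -> : tnth [tuple 1; 1; 1] s = 1 by case: s => -[|[|[]]].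
by have := hj s; case: (tnth j s) => [|[|[]]].
Qed.

(** * Closed walks as linear relations between the two steps *)

(** The steps of a walk: [None] crosses a spoke, [Some false] moves by [j_s] and
    [Some true] by [- j_s] in the current layer [s].  The sign of [Some b] is
    thus [(-1) ^+ b]. *)
Definition letter := option bool.

Definition letters : seq letter := [:: Some false; Some true; None].

(** The steps that may follow [l] in a walk without backtracking. *)
Definition turns (l : letter) : seq letter :=
  if l is Some b then [:: Some b; None] else [:: Some false; Some true].

Definition turn_back (l : letter) : letter := omap negb l.

(** A layer, and the net numbers of steps made in layer 0 and in layer 1. *)
Definition position := (bool * (int * int))%type.

Definition move (r : position) (l : letter) : position :=
  let: (s, (p, q)) := r in
  if l is Some b then
    (s, if s then (p, q + (-1) ^+ b)%R else (p + (-1) ^+ b, q)%R)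
  else (~~ s, (p, q)).

(** The walks that start with step [l] at [r] and make [L] more steps, each
    recorded by its last arc: a position and the step made from there. *)
Fixpoint ends L (r : position) (l : letter) : seq (position * letter) :=
  if L is L'.+1 then flatten [seq ends L' (move r l) m | m <- turns l]
  else [:: (r, l)].

(** A walk that ends on its first arc imposes the relation [p j_0 + q j_1 = 0],
    where [(p, q)] are its net numbers of steps. *)
Definition relations L s l : seq (int * int) :=
  [seq f.1.2 | f <- ends L (s, (0, 0)%R) l & (f.1.1 == s) && (f.2 == l)].

(** The class of an edge is [None] for spokes and [Some s] for the edges of layer
    [s]; the two parts are the two orientations. *)
Definition edge_relations L (c : option bool) : seq (int * int) :=
  if c is Some s then relations L s (Some false) ++ relations L s (Some true)
  else relations L false None ++ relations L true None.

Definition vanish n a b : pred (int * int) :=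
  fun r => n %| absz (r.1 * a%:Z + r.2 * b%:Z)%R.

Section TwoLayers.
Variables (n : nat) (j : 2.-tuple nat).
Hypotheses (n1 : 1 < n) (hj : forall s, 0 < tnth j s < n)
  (hj2 : forall s, 2 * tnth j s != n).

Definition lay (s : bool) : 'I_2 := if s then ord_max else ord0.
Local Notation J s := ((tnth j (lay s))%:R : 'Z_n)%R.

Lemma lay_inj : injective lay. Proof. by case=> [] []. Qed.

(** The vertex at position [r] when the origin has residue [v]. *)
Definition vertex (v : 'Z_n) (r : position) : 'I_2 * 'Z_n :=
  (lay r.1, v + r.2.1%:~R * J false + r.2.2%:~R * J true)%R.

Lemma vertex_origin v s : vertex v (s, (0, 0)%R) = (lay s, v).
Proof. by rewrite /vertex /= !mul0r !addr0. Qed.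

Lemma vertex_move v r l : (vertex v (move r l)).2 =
  ((vertex v r).2 + if l is Some b then (-1) ^+ b * J r.1 else 0)%R.
Proof.
case: r l => s [p q] [b|]; rewrite /vertex /= ?addr0 //.
by case: s => /=; rewrite rmorphD rmorphXn rmorphN1; ring.
Qed.

Lemma move_layer r l : (move r l).1 = if l is Some _ then r.1 else ~~ r.1.
Proof. by case: r l => s [p q] []. Qed.

Lemma vertex_moveE v r l : vertex v (move r l) =
  (lay (if l is Some _ then r.1 else ~~ r.1),
   (vertex v r).2 + if l is Some b then (-1) ^+ b * J r.1 else 0)%R.
Proof.
by rewrite -vertex_move -move_layer.
Qed.

Lemma vertex_moveI v r : injective (fun l => vertex v (move r l)).
Proof.
have neqJ s w : (w + 1 * J s == w + -1 * J s)%R = false.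
  by rewrite mul1r mulN1r; apply: step_neq_opp n1 hj hj2 _ _.
move=> l m /eqP; rewrite !vertex_moveE xpair_eqE (inj_eq lay_inj) /=.
by case: l m => [[]|] [[]|] //=; rewrite ?neqJ ?[(_ + -1 * _ == _)%R]eq_sym
  ?neqJ ?andbF //; case: r.1.
Qed.

Lemma GI_moves v r z :
  GI n j (vertex v r) z =
  (z \in [seq vertex v (move r l) | l <- letters]).
Proof.
rewrite /= !inE !vertex_moveE mul1r mulN1r addr0 /GI /=.
move: (_ + _)%R => w; case: z => s u; rewrite !xpair_eqE /=.
have -> : (s == lay (~~ r.1)) = (lay r.1 != s).
  by case: s => -[|[]] //; case: r.1.
by rewrite [lay _ == s]eq_sym [w == u]eq_sym orbC; case: (s == _) => /=;
  rewrite ?orbF.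
Qed.

Lemma GI_move v r l : GI n j (vertex v r) (vertex v (move r l)).
Proof.
rewrite GI_moves; apply: (map_f (fun l' => vertex v (move r l'))).
by case: l => [[]|].
Qed.

Lemma vertex_turn_back v r l :
  vertex v (move (move r l) (turn_back l)) = vertex v r.
Proof.
case: r l => s [p q] [[]|]; case: s => /=; rewrite ?subrK ?addrK //.
Qed.

(** Distinct letters lead from a vertex to distinct neighbours, and stepping back
    is the only letter missing from [turns l]; so the sum over the admissible
    next vertices is a sum over letters. *)
Lemma nb_walks_ends L x0 y0 v r l :
  nb_walks (GI n j) L x0 y0 (vertex v r) (vertex v (move r l)) =
  count (fun f => (vertex v f.1 == x0) && (vertex v (move f.1 f.2) == y0))
        (ends L r l).
Proof.
elim: L r l => [|L IHL] r l; first by rewrite /= addn0.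
rewrite [LHS]/= [ends _ _ _]/=.
have uniq_turns : uniq (turns l) by case: l.
rewrite count_flatten -map_comp sumnE big_map.
under [RHS]eq_bigr => m _ do rewrite /= -IHL.
rewrite -(big_map (fun m => vertex v (move (move r l) m)) predT
  (fun z => nb_walks (GI n j) L x0 y0 (vertex v (move r l)) z)).
rewrite big_uniq ?(map_inj_uniq (@vertex_moveI v _)) //=.
apply: eq_bigl => z; rewrite GI_moves -(vertex_turn_back v r l).
apply/idP/idP.
  move=> /andP[/mapP[m _ ->]]; rewrite (inj_eq (@vertex_moveI v _)) => ne.
  by apply: map_f; case: l m ne {uniq_turns} => [[]|] [[]|].
case/mapP => m m_l ->; rewrite (inj_eq (@vertex_moveI v _)).
apply/andP; split.
  apply: (map_f (fun l' => vertex v (move (move r l) l'))).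
  by case: m {m_l} => [[]|].
by case: l m m_l {uniq_turns} => [[]|] [[]|].
Qed.

Lemma vanishE r : vanish n (tnth j (lay false)) (tnth j (lay true)) r =
  (r.1%:~R * J false + r.2%:~R * J true == 0)%R.
Proof. by rewrite /vanish -Zp_int_eq0 // rmorphD !rmorphM. Qed.

Lemma nb_walks_relations L v s l :
  let x := vertex v (s, (0, 0)%R) in
  let y := vertex v (move (s, (0, 0)%R) l) in
  nb_walks (GI n j) L x y x y =
  count (vanish n (tnth j (lay false)) (tnth j (lay true))) (relations L s l).
Proof.
move=> x y; rewrite nb_walks_ends count_map count_filter.
apply: eq_count => -[r m] /=; rewrite vanishE.
have -> : (vertex v r == x) =
    (r.1 == s) && (r.2.1%:~R * J false + r.2.2%:~R * J true == 0)%R.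
  rewrite xpair_eqE (inj_eq lay_inj) /= !mul0r !addr0 -addrA.
  by rewrite -[X in (v + _ == X)%R]addr0 (inj_eq (addrI v)).
have [rs|] := eqVneq r.1 s; last by rewrite andbF.
have [r0|] //= := eqVneq (r.2.1%:~R * J false + r.2.2%:~R * J true)%R 0%R.
have Er : vertex v r = x.
  by rewrite /vertex rs -addrA r0 /x /vertex /= !mul0r !addr0.
rewrite -(inj_eq (@vertex_moveI v (s, (0, 0)%R))); congr (_ == _).
by rewrite !vertex_moveE -rs Er rs.
Qed.

End TwoLayers.

Definition det (r1 r2 : int * int) := absz (r1.1 * r2.2 - r2.1 * r1.2)%R.

Section TwoLayersRelations.
Variables (n : nat) (j : 2.-tuple nat).
Hypotheses (n1 : 1 < n) (hj : forall s, 0 < tnth j s < n)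
  (hj2 : forall s, 2 * tnth j s != n).
Local Notation a := (tnth j (lay false)).
Local Notation b := (tnth j (lay true)).

(** Each side is the number of closed walks through an edge of its class.  The
    edge is taken at residue 0; a reversed layer arc then starts at residue
    [j_s], which becomes the origin of its positions. *)
Lemma edge_relations_balanced L c :
  edge_transitive (GI n j) ->
  count (vanish n a b) (edge_relations L c) =
  count (vanish n a b) (edge_relations L None).
Proof.
move=> trans_j; pose v0 : 'Z_n := 0%R.
pose o s : position := (s, (0, 0)%R).
have walksE v s l := nb_walks_relations n1 hj hj2 L v s l.
have spokeE : closed_walks (GI n j) L
    (vertex j v0 (o false)) (vertex j v0 (move (o false) None)) =
    count (vanish n a b) (edge_relations L None).
  by rewrite /closed_walks walksE (walksE _ true None) count_cat.
case: c => // s; rewrite -spokeE.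
rewrite (closed_walks_edge L trans_j (GI_move _ _ _ _)
           (GI_move j v0 (o s) (Some false))).
have back : vertex j (vertex j v0 (move (o s) (Some false))).2
    (move (o s) (Some true)) = vertex j v0 (o s).
  rewrite vertex_moveE vertex_move /vertex /v0 /= !mul0r !addr0.
  by rewrite mul1r mulN1r addrK.
have start : vertex j (vertex j v0 (move (o s) (Some false))).2 (o s) =
    vertex j v0 (move (o s) (Some false)).
  by rewrite vertex_origin [RHS]surjective_pairing.
have := walksE (vertex j v0 (move (o s) (Some false))).2 s (Some true).
cbv zeta; rewrite -/(o s) start back => backE.
rewrite /closed_walks walksE backE.
exact: count_cat.
Qed.

(** By Cramer's rule the determinant of two relations kills both steps. *)
Lemma vanish_det r1 r2 : graph_connected (GI n j) ->
  vanish n a b r1 -> vanish n a b r2 ->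
  n %| det r1 r2.
Proof.
rewrite !vanishE // => conn_j /eqP r1_0 /eqP r2_0.
apply: (connected_dvd n1 (isT : 0 < 2) conn_j) => s.
rewrite rmorphB !rmorphM /=.
have [->|->] : s = lay false \/ s = lay true.
  by case: s => -[|[]] // i; [left | right]; apply: val_inj.
- transitivity (r2.2%:~R * (r1.1%:~R * a%:R + r1.2%:~R * b%:R)
    - r1.2%:~R * (r2.1%:~R * a%:R + r2.2%:~R * b%:R) : 'Z_n)%R; first by ring.
  by rewrite r1_0 r2_0 !mulr0 subr0.
- transitivity (r1.1%:~R * (r2.1%:~R * a%:R + r2.2%:~R * b%:R)
    - r2.1%:~R * (r1.1%:~R * a%:R + r1.2%:~R * b%:R) : 'Z_n)%R; first by ring.
  by rewrite r1_0 r2_0 !mulr0 subr0.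
Qed.
End TwoLayersRelations.

(** * The balance of closed walks bounds the modulus *)

(** A relation and its opposite hold together, so they are counted together. *)
Definition canon (r : int * int) : int * int :=
  if ((r.1 < 0) || (r.1 == 0) && (r.2 < 0))%R then (- r.1, - r.2)%R else r.

(** The multiplicities are collected to keep the computations small. *)
Definition edge_tally L c := tally (map canon (edge_relations L c)).

Definition weight (z : pred (int * int)) (bs : seq (int * int * nat)) :=
  sumn [seq m.2 * z m.1 | m <- bs].

Lemma count_tally (T : eqType) (z : pred T) (s : seq T) :
  count z s = sumn [seq m.2 * z m.1 | m <- tally s].
Proof.
rewrite -(seq.permP (tallyK s)) /tally_seq count_flatten -map_comp.
by congr sumn; apply: eq_map => m /=; rewrite count_nseq mulnC.
Qed.

Lemma vanish_canon n a b r : vanish n a b (canon r) = vanish n a b r.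
Proof.
rewrite /vanish /canon; case: ifP => // _ /=.
by rewrite !mulNr -opprD abszN.
Qed.

Lemma weight_edge_tally n a b L c :
  weight (vanish n a b) (edge_tally L c) =
  count (vanish n a b) (edge_relations L c).
Proof.
rewrite /weight -count_tally count_map; apply: eq_count => r.
exact: vanish_canon.
Qed.

(** The bindings make a computation of [balanced L] on many predicates evaluate
    the tallies only once. *)
Definition balanced L : pred (pred (int * int)) :=
  let spokes := edge_tally L None in
  let outer := edge_tally L (Some false) in
  let inner := edge_tally L (Some true) in
  fun z => (weight z outer == weight z spokes) &&
           (weight z inner == weight z spokes).

Lemma edge_transitive_balanced n (j : 2.-tuple nat) L :
  1 < n -> (forall s, 0 < tnth j s < n) -> (forall s, 2 * tnth j s != n) ->
  edge_transitive (GI n j) ->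
  balanced L (vanish n (tnth j (lay false)) (tnth j (lay true))).
Proof.
move=> n1 hj hj2 trans_j; rewrite /balanced !weight_edge_tally.
by rewrite !(edge_relations_balanced n1 hj hj2 _ _ trans_j) eqxx.
Qed.

Ltac evaluate t :=
  let v := eval vm_compute in t in have -> : t = v by vm_compute.

(** Up to the factor 2 for the orientations, the excess of the count at a spoke
    over the count at an edge of layer 0 is [2 + z(2,2) + z(2,-2) - z(8,0)] plus
    the sum over both signs [e] of [z(1,5e) - z(3,3e) - 2 z(4,2e) - 3 z(5,e)];
    exchanging the coordinates gives the excess over layer 1.  Both excesses
    vanish, so in each of them negative terms of total weight at least 2 must
    hold; over layer 0, two of the terms of weight 1 are needed in the absence of
    heavier ones. *)
Lemma balanced8_relations (z : pred (int * int)) :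
  z (0, 0)%Z -> ~~ z (2, 0)%Z -> ~~ z (0, 2)%Z -> balanced 8 z ->
  [|| has z [:: (4, 2); (4, -2); (5, 1); (5, -1)]%Z,
      z (3, 3)%Z && z (3, -3)%Z |
      (z (3, 3)%Z || z (3, -3)%Z) && z (8, 0)%Z] &&
  has z [:: (3, 3); (3, -3); (2, 4); (2, -4); (1, 5); (1, -5)]%Z.
Proof.
move=> z00 z20 z02; rewrite /balanced.
evaluate (edge_tally 8 None).
evaluate (edge_tally 8 (Some false)).
evaluate (edge_tally 8 (Some true)).
rewrite /weight /= z00 (negbTE z20) (negbTE z02) !muln0 !muln1 !addn0.
move: (z (4, 2)%Z) (z (4, -2)%Z) (z (5, 1)%Z) (z (5, -1)%Z) => p4 q4 p5 q5.
move: (z (3, 3)%Z) (z (3, -3)%Z) (z (2, 4)%Z) (z (2, -4)%Z) => p3 q3 p2 q2.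
move: (z (1, 5)%Z) (z (1, -5)%Z) => p1 q1.
move: (z (2, 2)%Z) (z (2, -2)%Z) => p0 q0.
move: (z (8, 0)%Z) (z (0, 8)%Z) => p8 q8.
case/andP => /eqP eqF /eqP eqT; apply/andP; split.
- clear eqT.
  case: p4 eqF => [//|]; case: q4 => [//|].
  case: p5 => [//|]; case: q5 => [//|] /=.
  by case: p3 q3 p8 => [] [] [] //=; lia.
- clear eqF.
  case: p3 eqT => [//|]; case: q3 => [//|]; case: p2 => [//|].
  case: q2 => [//|]; case: p1 => [//|]; case: q1 => [//|] /=.
  lia.
Qed.

(** The relations provided by [balanced8_relations] always contain two that are
    not proportional, and the largest determinant is
    [5 * 5 + 1 = 26], from [(5, 1)] and [(1, -5)]. *)
Lemma balanced8_bound n a b :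
  ~~ vanish n a b (2, 0)%Z -> ~~ vanish n a b (0, 2)%Z ->
  balanced 8 (vanish n a b) ->
  (forall r1 r2, vanish n a b r1 -> vanish n a b r2 -> n %| det r1 r2) ->
  n <= 26.
Proof.
move=> z20 z02 bal Hdet.
have z00 : vanish n a b (0, 0)%Z by rewrite /vanish !mul0r.
have := balanced8_relations z00 z20 z02 bal.
move: (vanish n a b) Hdet => z Hdet {z20 z02 z00 bal}.
have bound r1 r2 : z r1 && z r2 -> 0 < det r1 r2 <= 26 -> n <= 26.
  move=> /andP[zr1 zr2] /andP[det_gt0]; apply: leq_trans.
  exact: dvdn_leq (Hdet _ _ zr1 zr2).
case/andP => + short; case/or3P => [/hasP[r1 in1 zr1]| |].
- have /hasP[r2 in2 zr2] := short.
  apply: (bound r1 r2); first by rewrite zr1.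
  have ok : all (fun r => all (fun r' => 0 < det r r' <= 26)
    [:: (3, 3); (3, -3); (2, 4); (2, -4); (1, 5); (1, -5)]%Z)
    [:: (4, 2); (4, -2); (5, 1); (5, -1)]%Z by vm_compute.
  by have /allP/(_ _ in2) := allP ok _ in1.
- by move=> /bound/(_ isT).
- by rewrite andb_orl => /orP[] /bound/(_ isT).
Qed.

(** * Small moduli *)

Definition exceptional : seq (nat * nat) :=
  [:: (4, 1); (5, 2); (8, 3); (10, 2); (10, 3); (12, 5); (24, 5)].

Definition scales_to n a b k := has (fun u => coprime n u &&
  (eq_up_to_sign n (u * a) 1 && eq_up_to_sign n (u * b) k
   || eq_up_to_sign n (u * a) k && eq_up_to_sign n (u * b) 1)) (iota 0 n).

(** The moduli range from 3 to 26. *)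
Definition small_parameters : seq (nat * (nat * nat)) :=
  flatten [seq [seq (n, (a, b)) | a <- iota 1 n.-1, b <- iota 1 n.-1]
          | n <- iota 3 24].

Definition connected_parameters (x : nat * (nat * nat)) :=
  [&& 2 * x.2.1 != x.1, 2 * x.2.2 != x.1 & coprime (gcdn x.2.1 x.2.2) x.1].

Definition vanishing (x : nat * (nat * nat)) := vanish x.1 x.2.1 x.2.2.

Definition is_exceptional (x : nat * (nat * nat)) :=
  has (fun m => (m.1 == x.1) && scales_to x.1 x.2.1 x.2.2 m.2) exceptional.

(** As in [balanced], the binding shares the tallies between all parameters. *)
Definition balanced_at L : pred (nat * (nat * nat)) :=
  let balancedL := balanced L in fun x => balancedL (vanishing x).

Lemma all_filter3 (T : eqType) (p q r e : pred T) (s : seq T) :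
  all e (filter p (filter q (filter r s))) ->
  forall x, x \in s -> r x -> q x -> p x -> e x.
Proof.
move/allP=> all_e x xs rx qx px; apply: all_e.
by rewrite !mem_filter px qx rx.
Qed.

(** A finite verification.  Filtering successively restricts the costly length
    10, and the search for a unit, to the few parameters balanced in length 8. *)
Lemma small_exceptional x :
  x \in small_parameters -> connected_parameters x ->
  balanced_at 8 x -> balanced_at 10 x -> is_exceptional x.
Proof.
move: x; apply: (@all_filter3 _ (balanced_at 10) (balanced_at 8)
  connected_parameters is_exceptional small_parameters).
by vm_compute.
Qed.

Lemma scales_to_petersen n (j : 2.-tuple nat) k : 1 < n ->
  scales_to n (tnth j (lay false)) (tnth j (lay true)) k ->
  graph_iso (GI n j) (petersen n k).
Proof.
have ord2 (P : 'I_2 -> Prop) : P (lay false) -> P (lay true) -> forall s, P s.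
  by move=> PF PT [[|[]] // i]; [move: PF | move: PT];
    rewrite (_ : lay _ = Ordinal i) //; apply: val_inj.
move=> n1 /hasP[u _ /andP[co_u /orP[]/andP[sa sb]]].
  by apply: (GI_iso_scale (f := id)) co_u _ _ => //; apply: ord2.
by apply: (GI_iso_scale (f := @rev_ord 2)) co_u (@rev_ord_inj 2) _ => //;
  apply: ord2.
Qed.

Lemma edge_transitive_two_layers n (j : 2.-tuple nat) :
  3 <= n -> (forall s, 0 < tnth j s < n) -> (forall s, 2 * tnth j s != n) ->
  graph_connected (GI n j) -> edge_transitive (GI n j) ->
  exists2 m, m \in exceptional & graph_iso (GI n j) (petersen m.1 m.2).
Proof.
move=> n3 hj hj2 conn_j trans_j.
have n1 : 1 < n by apply: leq_trans n3.
pose a := tnth j (lay false); pose b := tnth j (lay true).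
have z20 : ~~ vanish n a b (2, 0)%Z.
  rewrite vanishE // mul0r addr0 //.
  by rewrite -pmulrn mulr2n mulrDl mul1r; apply: step2_neq0.
have z02 : ~~ vanish n a b (0, 2)%Z.
  rewrite vanishE // mul0r add0r.
  by rewrite -pmulrn mulr2n mulrDl mul1r; apply: step2_neq0.
have bal L := edge_transitive_balanced L n1 hj hj2 trans_j.
have bal_at L : balanced_at L (n, (a, b)) by exact: bal.
have le_n : n <= 26.
  apply: (balanced8_bound z20 z02 (bal 8)) => r1 r2.
  exact: vanish_det.
(* A common divisor [d] of both steps and [n] would make [n / d] kill the steps. *)
have co_ab : coprime (gcdn a b) n.
  have d0 : 0 < gcdn (gcdn a b) n by rewrite gcdn_gt0 (ltnW n1) orbT.
  have dvd_n : gcdn (gcdn a b) n %| n by apply: dvdn_gcdr.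
  have dvd_j s : gcdn (gcdn a b) n %| tnth j s.
    apply: dvdn_trans (dvdn_gcdl _ _) _.
    have [->|->] : s = lay false \/ s = lay true.
      by case: s => -[|[]] // i; [left | right]; apply: val_inj.
    - exact: dvdn_gcdl.
    - exact: dvdn_gcdr.
  have: n %| n %/ gcdn (gcdn a b) n.
    apply: (connected_dvd (m := (n %/ _)%:Z) n1 _ conn_j) => // s.
    apply/eqP; rewrite -pmulrn -natrM Zp_nat_eq0 //.
    by rewrite divn_mulAC // -muln_divA // dvdn_mulr.
  move/(dvdn_leq _); rewrite divn_gt0 // => /(_ (dvdn_leq (ltnW n1) dvd_n)).
  rewrite /coprime eqn_leq d0 andbT.
  have := divnK dvd_n; nia.
have: is_exceptional (n, (a, b)).
  refine (small_exceptional _ _ (bal_at 8) (bal_at 10)); last first.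
    by rewrite /connected_parameters !hj2 co_ab.
  apply/flatten_mapP; exists n; first by rewrite mem_iota; lia.
  apply/allpairsP; exists (a, b); rewrite /= !mem_iota.
  have := hj (lay false); have := hj (lay true).
  by rewrite -/a -/b; split=> //; lia.
case/hasP => m in_m /andP[/eqP Em sc]; exists m; rewrite // Em.
exact: scales_to_petersen.
Qed.

(** * The classification *)

Theorem corollary6 (n t : nat) (j : t.-tuple nat)
    (hn : 3 <= n) (ht : 2 <= t)
    (hj : forall s : 'I_t, 0 < tnth j s < n)
    (hj2 : forall s : 'I_t, 2 * tnth j s != n)
    (hconn : graph_connected (GI n j))
    (hedge : edge_transitive (GI n j)) :
  graph_iso (GI n j) (petersen 4 1) \/
  graph_iso (GI n j) (petersen 5 2) \/
  graph_iso (GI n j) (petersen 8 3) \/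
  graph_iso (GI n j) (petersen 10 2) \/
  graph_iso (GI n j) (petersen 10 3) \/
  graph_iso (GI n j) (petersen 12 5) \/
  graph_iso (GI n j) (petersen 24 5) \/
  graph_iso (GI n j) (GI 3 [tuple 1; 1; 1]).
Proof.
have [t3 | t2] := leqP 3 t.
  by do 7!right; apply: edge_transitive_many_layers.
have Et : t = 2 by lia.
subst t.
have [m + iso_m] := edge_transitive_two_layers hn hj hj2 hconn hedge.
rewrite !inE; do ?[case/orP]; move=> /eqP Em; move: iso_m; rewrite {}Em /=.
all: tauto.
Qed.
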